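(* Every star-shaped Coxeter group $W$ as in the context has the $R_\infty$-property.
   Context: Setting. Let $n\ge 2$, $I=\{1,\dots,n\}$, and let $m_1,\dots,m_n\ge 2$ be integers. $W$ is the star-shaped Coxeter group with Coxeter generating set $S=\{s_0,s_1,\dots,s_n\}$ and presentation $W=\langle S\mid s_i^2=1\ (0\le i\le n),\ (s_0s_j)^{m_j}=1\ (1\le j\le n)\rangle$ (there is no relation between $s_i$ and $s_j$ for distinct $i,j\in I$). Standing assumption: at least one $m_i$ is even. A group $G$ has the $R_\infty$-property if for every $\varphi\in\operatorname{Aut}(G)$ the number of $\varphi$-twisted conjugacy classes is infinite, where $x,y\in G$ are $\varphi$-twisted conjugate if $y=gx\varphi(g)^{-1}$ for some $g\in G$. *)

(* Defs.v *)
From HB Require Import structures.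
From mathcomp Require Import all_boot.
From mathcomp Require Import boolp classical_sets functions cardinality.

Set Implicit Arguments.
Unset Strict Implicit.
Unset Printing Implicit Defensive.

Local Open Scope group_scope.
Local Open Scope quotient_scope.

(* A word is a sequence of signed letters: (x, true) stands for the generator
   x and (x, false) for its inverse. *)
Notation word X := (seq (X * bool)).

Definition invl {X : Type} (a : X * bool) : X * bool := (a.1, ~~ a.2).

Definition invw {X : Type} (w : word X) : word X := rev (map invl w).

(* The least congruence on words that allows free cancellation and identifies
   every relator with the empty word. *)
Inductive word_eq {X : Type} (R : set (word X)) : word X -> word X -> Prop :=
| weq_refl u : word_eq R u u
| weq_sym u v : word_eq R u v -> word_eq R v u
| weq_trans v u w : word_eq R u v -> word_eq R v w -> word_eq R u w
| weq_cancel u v a : word_eq R (u ++ [:: a; invl a] ++ v) (u ++ v)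
| weq_rel u v r : R r -> word_eq R (u ++ r ++ v) (u ++ v).

Section WordEq.
Variables (X : Type) (R : set (word X)).
Implicit Types (u v w : word X) (a : X * bool).

Lemma invlK a : invl (invl a) = a.
Proof. by case: a => x b; rewrite /invl /= negbK. Qed.

Lemma invw_cat u v : invw (u ++ v) = invw v ++ invw u.
Proof. by rewrite /invw map_cat rev_cat. Qed.

Lemma invw_cons a u : invw (a :: u) = invw u ++ [:: invl a].
Proof. by rewrite -cat1s invw_cat. Qed.

Lemma invwK u : invw (invw u) = u.
Proof. by elim: u => // a u IH; rewrite invw_cons invw_cat IH /= invlK. Qed.

Lemma weq_ctx p q u v : word_eq R u v -> word_eq R (p ++ u ++ q) (p ++ v ++ q).
Proof.
elim=> {u v} [u|u v _ IH|v u w _ IH1 _ IH2|u v a|u v r Rr].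
- exact: weq_refl.
- exact: weq_sym.
- exact: weq_trans IH1 IH2.
- have := weq_cancel R (p ++ u) (v ++ q) a.
  by rewrite -!catA.
- have := weq_rel (p ++ u) (v ++ q) Rr.
  by rewrite -!catA.
Qed.

Lemma weq_cat u u' v v' :
  word_eq R u u' -> word_eq R v v' -> word_eq R (u ++ v) (u' ++ v').
Proof.
move=> /(weq_ctx [::] v) /= uu' /(weq_ctx u' [::]).
by rewrite !cats0; apply: weq_trans.
Qed.

Lemma weq_catV u : word_eq R (u ++ invw u) [::].
Proof.
elim: u => [|a u IH]; first exact: weq_refl.
rewrite invw_cons -cat1s -catA; apply: (weq_trans (v := [:: a; invl a])).
  by have := weq_ctx [:: a] [:: invl a] IH; rewrite -catA.
exact: (weq_cancel R [::] [::] a).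
Qed.

Lemma weq_Vcat u : word_eq R (invw u ++ u) [::].
Proof. by have := weq_catV (invw u); rewrite invwK. Qed.

Lemma weq_inv u v : word_eq R u v -> word_eq R (invw u) (invw v).
Proof.
move=> uv.
apply: (weq_trans (v := invw u ++ v ++ invw v)).
  apply: weq_sym; rewrite -[X in word_eq _ _ X]cats0.
  apply: weq_cat; [exact: weq_refl | exact: weq_catV].
rewrite -[X in word_eq _ _ X]cat0s catA.
apply: weq_cat; last exact: weq_refl.
apply: weq_trans (weq_Vcat u).
by apply: weq_cat; [exact: weq_refl | exact: weq_sym].
Qed.

End WordEq.

Section PresentedGroup.
Variables (X : choiceType) (R : set (word X)).

Definition word_eqb : rel (word X) := fun u v => `[< word_eq R u v >].

Lemma word_eqb_refl : reflexive word_eqb.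
Proof. by move=> u; apply/asboolP; apply: weq_refl. Qed.

Lemma word_eqb_sym : symmetric word_eqb.
Proof. by move=> u v; apply/asboolP/asboolP; apply: weq_sym. Qed.

Lemma word_eqb_trans : transitive word_eqb.
Proof.
by move=> v u w /asboolP uv /asboolP vw; apply/asboolP; apply: weq_trans vw.
Qed.

Canonical word_equiv :=
  EquivRel word_eqb word_eqb_refl word_eqb_sym word_eqb_trans.

(* The group <X | R>. *)
Definition presented_group := {eq_quot word_equiv}.

HB.instance Definition _ := Choice.on presented_group.

Definition class_of_word (w : word X) : presented_group :=
  \pi_({eq_quot word_equiv}) w.

Definition pg_mul (x y : presented_group) : presented_group :=
  class_of_word (repr x ++ repr y).
Definition pg_one : presented_group := class_of_word [::].
Definition pg_inv (x : presented_group) : presented_group :=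
  class_of_word (invw (repr x)).

Lemma class_of_wordP u v : class_of_word u = class_of_word v <-> word_eq R u v.
Proof.
split=> [/eqmodP /asboolP //|uv]; apply/eqmodP; exact/asboolP.
Qed.

Lemma class_of_wordK x : class_of_word (repr x) = x.
Proof. exact: reprK. Qed.

Lemma repr_class u : word_eq R (repr (class_of_word u)) u.
Proof. by apply/class_of_wordP; rewrite class_of_wordK. Qed.

Lemma pg_mulE u v :
  pg_mul (class_of_word u) (class_of_word v) = class_of_word (u ++ v).
Proof. by apply/class_of_wordP; apply: weq_cat; apply: repr_class. Qed.

Lemma pg_invE u : pg_inv (class_of_word u) = class_of_word (invw u).
Proof. by apply/class_of_wordP; apply: weq_inv; apply: repr_class. Qed.

Lemma pg_mulA : associative pg_mul.
Proof.
move=> x y z; rewrite -(class_of_wordK x) -(class_of_wordK y).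
by rewrite -(class_of_wordK z) !pg_mulE catA.
Qed.

Lemma pg_mul1 : left_id pg_one pg_mul.
Proof. by move=> x; rewrite -(class_of_wordK x) pg_mulE. Qed.

Lemma pg_mulr1 : right_id pg_one pg_mul.
Proof. by move=> x; rewrite -(class_of_wordK x) pg_mulE cats0. Qed.

Lemma pg_mulV : left_inverse pg_one pg_inv pg_mul.
Proof.
move=> x; rewrite -(class_of_wordK x) pg_invE pg_mulE.
by apply/class_of_wordP; apply: weq_Vcat.
Qed.

Lemma pg_mulrV : right_inverse pg_one pg_inv pg_mul.
Proof.
move=> x; rewrite -(class_of_wordK x) pg_invE pg_mulE.
by apply/class_of_wordP; apply: weq_catV.
Qed.

HB.instance Definition _ := isGroup.Build presented_group
  pg_mulA pg_mul1 pg_mulr1 pg_mulV pg_mulrV.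

End PresentedGroup.

(* The generator s_0 is ord0 and s_j is lift ord0 j; the index set {1, ..., n}
   is represented by 'I_n, shifted by one. *)
Definition star_relators (n : nat) (m : 'I_n -> nat) : set (word 'I_n.+1) :=
  [set r | (exists i : 'I_n.+1, r = nseq 2 (i, true)) \/
           (exists j : 'I_n,
              r = flatten (nseq (m j) [:: (ord0, true); (lift ord0 j, true)]))].

Definition star_coxeter (n : nat) (m : 'I_n -> nat) : groupType :=
  presented_group (star_relators m).

Definition twisted_class (G : groupType) (phi : G -> G) (x : G) : set G :=
  [set y | exists g : G, y = g * x * (phi g)^-1].

Definition R_infinity (G : groupType) : Prop :=
  forall phi : {multiplicative G -> G}, bijective phi ->
    infinite_set (range (twisted_class phi)).

(* Main.v *)
From HB Require Import structures.
Require Import Defs.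
From mathcomp Require Import all_boot all_algebra all_fingroup all_solvable.
From mathcomp Require Import boolp.
From mathcomp Require classical_sets cardinality.

(* A finite index subgroup F stable under phi detects the property: each class
   splits into finitely many classes for twisting by F alone. Except for m =
   (2, 2), F can be mapped, for infinitely many primes p, onto the alternating
   group A_p, by letting W act on two copies of V * A_p, where V is a finite
   abelian group on which the rotations s_j s_0 act by translations; the
   translations of V * A_p are conjugated by a gauge transformation whose
   holonomy along two commutators generates A_p.

   Let f : F -> A_p be such a map and let N <= F be normal of finite index
   smaller than |A_p|; then f maps N onto A_p. The maps f o phi^i have
   finitely many kernels and, A_p being simple, distinct kernels are
   independent, so some x in N has f x = s arbitrary and f (phi^i x) = 1 for 0
   < i < k, where k is the first exponent with ker (f o phi^k) = ker f. If x
   were twisted conjugate to an element y with f (phi^i y) = 1 for all i < k,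
   then multiplying the relations for 0 <= i < k would yield s = beta u *
   u^-1, with beta the automorphism of A_p induced by phi^-k. No automorphism
   beta of A_p makes u |-> beta u * u^-1 surjective, so for a suitable s the
   class of x is lost on replacing N by a smaller subgroup of finite index.
   This can be repeated forever.

   For m = (2, 2) put t = s_1 s_2. The squares of W lie in the infinite cyclic
   group <t^2>, so phi (t^2) = t^2 or t^-2, and the elements t^2k, resp. t^2k
   s_1, are pairwise inequivalent under twisting by <t^2>. *)

Set Implicit Arguments.
Unset Strict Implicit.
Unset Printing Implicit Defensive.

Local Open Scope group_scope.

(** * Alternating groups *)

(** A p-cycle [c] and its conjugate by a transposition [t] generate a group normalised by [c] and
    [t]. In prime degree these two generate the symmetric group, so simplicity of ['Alt_T]
    applies. *)
Lemma Alt_2generated (T : finType) :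
  prime #|T| -> 4 < #|T| -> exists a b : {perm T}, <<[set a; b]>> = 'Alt_T.
Proof.
move=> pT T5.
have /card_gt1P[x [y [_ _ nxy]]] : 1 < #|T| by exact: prime_gt1.
have [c _ oc] : {c | c \in 'Sym_T & #[c] = #|T|}.
  apply: Cauchy => //; rewrite card_Sym; apply: dvdn_fact.
  by rewrite leqnn andbT prime_gt0.
have evenc : c \in 'Alt_T.
  have odd_T : odd #|T| by case/even_prime: pT T5 => [->|->].
  rewrite Alt_even; have := congr1 (@odd_perm T) (expg_order c).
  have oddX k : odd_perm (c ^+ k) = odd k && odd_perm c.
    by elim: k => [|k IH]; rewrite ?odd_perm1 // expgS odd_permM IH /=; case: odd odd_perm => [] [].
  by rewrite oc odd_perm1 oddX odd_T /= => ->.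
pose t := tperm x y; exists c, (c ^ t).
set D := <<_>>.
have DA : D \subset 'Alt_T.
  rewrite gen_subG; apply/subsetP=> z /set2P[] -> //.
  by rewrite memJ_norm //; apply: (subsetP (Alt_norm T)); rewrite inE.
have nD : 'Sym_T \subset 'N(D).
  rewrite -(gen_tperm_circular_shift pT nxy oc) gen_subG.
  apply/subsetP=> z /set2P[] ->; last first.
    by apply: (subsetP (normG _)); rewrite mem_gen // set21.
  apply/normP; rewrite -genJ; congr <<_>>.
  rewrite conjUg !conjg_set1 -conjgM tperm2 conjg1; exact: setUC.
have /simpleP[_ sA] := simple_Alt5 T5.
have /sA[D1|//] : D <| 'Alt_T.
  by apply/andP; split=> //; apply: subset_trans nD; exact: Alt_subset.
have : c \in D by rewrite mem_gen // set21.
by rewrite /D D1 => /set1gP c1; move: oc T5; rewrite c1 order1 => <-.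
Qed.

(* For a beta-stable conjugate P of <[c]>, beta commutes with the abelian
   group Aut P, so beta u * u^-1 centralises P when u normalises it;
   injectivity of that map then forces 'N(P) = 'C(P). *)
Lemma no_transitive_twist (gT : finGroupType) (p : nat) (c d : gT)
    (beta : {morphism [set: gT] >-> gT}) :
  p.-Sylow([set: gT]) <[c]> -> c ^ d \in <[c]> -> c ^ d != c -> 'injm beta ->
  exists s, forall u, s != beta u * u^-1.
Proof.
move=> sylP cdP cdc injb.
have [/existsP[s /forallP sP]|/existsPn nos] :=
  boolP [exists s, [forall u, s != beta u * u^-1]]; first by exists s.
have onto s : exists u, s = beta u * u^-1.
  have /forallPn[u] := nos s; rewrite negbK => /eqP ->; by exists u.
have bT : beta @* [set: gT] = [set: gT].
  by apply/eqP; rewrite eqEcard subsetT card_injm //= leqnn.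
have inj : injective (fun u => beta u * u^-1).
  have /eqP cimg : #|[set beta u * u^-1 | u in [set: gT]]| == #|[set: gT]|.
    rewrite eqn_leq leq_imset_card /=; apply/subset_leq_card/subsetP=> s _.
    by have [v ->] := onto s; apply: imset_f.
  by move=> v w vw; apply: (imset_injP (introT eqP cimg)); rewrite ?inE.
have [x _ Px] : exists2 x, x \in [set: gT] & beta @* <[c]> = <[c]> :^ x.
  apply: (Sylow_trans sylP); rewrite -[X in _.-Sylow(X)]bT.
  by rewrite injm_pHall // subsetT.
(* Such a [u] satisfies x * beta u = u, which makes the conjugate of [<[c]>] by [u] stable under
   [beta]. *)
have [u ux] := onto x^-1.
have {ux}xu : x * beta u = u.
  by rewrite -[beta u](mulgVK u) -ux mulKVg.
pose e := c ^ u; pose P := <[e]>.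
have PE : P = <[c]> :^ u by rewrite /P cycleJ.
have bP : beta @* P = P.
  by rewrite PE morphimJ ?inE //= Px -conjsgM xu.
have bC n : n \in 'N(P) -> beta n * n^-1 \in 'C(P).
  move=> nN.
  have [k ek] : exists k, e ^ n = e ^+ k.
    by apply/cycleP; rewrite memJ_norm // cycle_id.
  have gb : <[beta e]> = P by rewrite -morphim_cycle ?inE.
  have ben : beta e ^ n = (beta e) ^+ k.
    have : beta e \in P by rewrite -gb cycle_id.
    by case/cycleP=> l ->; rewrite conjXg ek -!expgM mulnC.
  have beb : beta e ^ beta n = (beta e) ^+ k.
    by rewrite -morphJ ?inE // ek morphX ?inE.
  rewrite -gb cent_cycle; apply/cent1P/commute_sym/commgP/conjg_fixP.
  by rewrite conjgM beb -ben conjgK.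
have NC : 'N(P) \subset 'C(P).
  suff /eqP -> : 'C(P) == 'N(P) by [].
  rewrite eqEcard cent_sub -(card_imset (mem 'N(P)) inj).
  by apply/subset_leq_card/subsetP=> _ /imsetP[n nN ->]; apply: bC.
have : d ^ u \in 'C(P).
  by rewrite (subsetP NC) // PE normJ memJ_conjg -cycle_subG norms_cycle.
rewrite PE centJ memJ_conjg cent_cycle => /cent1P/commute_sym/commgP/conjg_fixP.
by move/eqP; rewrite (negPf cdc).
Qed.

(** On the affine line over F_p, [c] is x |-> x + 1 and [d] is x |-> 4x: multiplication by 2 is
    squared to make it even. It conjugates [c] to c^4, which differs from [c] since p > 3. *)
Lemma Alt_Sylow_cycle (p : nat) : prime p -> 4 < p ->
  exists c d : {perm 'F_p},
    [/\ p.-Sylow('Alt_('F_p)) <[c]>, c \in 'Alt_('F_p), d \in 'Alt_('F_p),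
        c ^ d \in <[c]> & c ^ d != c].
Proof.
move=> pp p5; have cT : #|'F_p| = p by rewrite card_Fp.
pose c : {perm 'F_p} := perm (@GRing.addrI _ (1%R : 'F_p)).
have cE k x : (c ^+ k) x = (k%:R + x)%R.
  elim: k => [|k IH]; first by rewrite perm1 GRing.add0r.
  by rewrite expgSr permM IH permE -GRing.natr1 GRing.addrCA GRing.addrA.
have nat0 k : (k%:R == 0 :> 'F_p)%R = (p %| k) by rewrite (GRing.dvdn_pcharf (pchar_Fp pp)).
have n2 : (2%:R != 0 :> 'F_p)%R.
  by rewrite nat0; apply: contraL p5 => /dvdn_leq-/(_ isT) p2; rewrite -leqNgt; apply: leq_trans p2 _.
pose e : {perm 'F_p} := perm (GRing.mulfI n2).
have oc : #[c] = p.
  have /primeP[_ pdiv] := pp.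
  have /pdiv/orP[/eqP|/eqP//] : #[c] %| p.
    rewrite order_dvdn; apply/eqP/permP=> x.
    by rewrite cE perm1; have /eqP -> : (p%:R == 0 :> 'F_p)%R; rewrite ?nat0 // GRing.add0r.
  move/eqP; rewrite order_eq1 => /eqP c1; have := cE 1%N 0%R.
  by rewrite expg1 c1 perm1 GRing.addr0 => /esym/eqP; rewrite GRing.oner_eq0.
have oddp : odd p by case/even_prime: pp p5 => [->|].
have ceven : c \in 'Alt_('F_p).
  have oddX k : odd_perm (c ^+ k) = odd k && odd_perm c.
    by elim: k => [|k IH]; rewrite ?odd_perm1 // expgS odd_permM IH /=;
       case: odd odd_perm => [] [].
  rewrite Alt_even; have := congr1 (@odd_perm _) (expg_order c).
  by rewrite oc odd_perm1 oddX oddp /= => ->.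
have ce : c ^ (e * e) = c ^+ 4.
  apply: (mulgI (e * e)); rewrite -conjgC; apply/permP=> x.
  by rewrite [RHS]permM cE !permM !permE /= !GRing.mulrDr GRing.mulr1 -!GRing.natrM.
exists c, (e * e); split=> //.
- rewrite pHallE cycle_subG ceven /= -orderE oc p_part.
  (* The order is p!/2, and p divides p! exactly once. *)
  suff -> : logn p #|'Alt_('F_p)| = 1%N by [].
  have : logn p (2 * #|'Alt_('F_p)|) = logn p p`!.
    by rewrite card_Alt cT // prime_gt1.
  rewrite lognM ?cardG_gt0 // logn_prime //.
  rewrite -[in RHS](prednK (prime_gt0 pp)) factS lognM ?fact_gt0 // prednK ?prime_gt0 //.
  rewrite [logn p p]logn_prime // eqxx [logn p _`!]logn_fact // big_nat_cond big1 ?addn0.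
    by case: eqP p5 => [->|_ _] //; rewrite add0n addn0.
  move=> k /andP[/andP[k1 _] _]; rewrite divn_small //.
  rewrite prednK ?prime_gt0 // -[X in X <= _]expn1.
  by rewrite leq_exp2l // prime_gt1.
- by rewrite Alt_even odd_permM addbb.
- by rewrite ce mem_cycle.
rewrite ce; apply/negP=> /eqP/permP/(_ 0%R).
rewrite cE -[c]expg1 cE !GRing.addr0 -[4]/(1 + 3)%N GRing.natrD.
rewrite -[RHS]GRing.addr0 => /GRing.addrI/eqP; rewrite nat0.
by apply/negP; apply: contraL p5 => /dvdn_leq-/(_ isT) p3; rewrite -leqNgt ltnW.
Qed.

(** The group is A_p with p > M + 5, retyped through [subg_of] so as to be a full group type. *)
Lemma exists_no_transitive_twist (M : nat) : exists Q : finGroupType,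
  [/\ M < #|Q|, simple [set: Q], ~~ abelian [set: Q],
      exists a b : Q, <<[set a; b]>> = [set: Q] &
      forall beta : {morphism [set: Q] >-> Q}, 'injm beta ->
        exists s, forall u, s != beta u * u^-1].
Proof.
have [p pM pp] := prime_above (M + 5).
pose T : finType := 'F_p; pose A : {group {perm T}} := 'Alt_T.
have cT : #|T| = p by rewrite card_Fp.
have p5 : 4 < p by apply: leq_trans pM; rewrite ltnS -addSnnS leq_addl.
have T5 : 4 < #|T| by rewrite cT.
have smpA : simple A by exact: simple_Alt5.
have nabA : ~~ abelian A.
  by apply: contraFN (solvable_AltF T5); exact: abelian_sol.
have cA : (2 * #|A|)%N = p`! by rewrite card_Alt ?cT // prime_gt1.
exists (subg_of A); split.
- rewrite -cardsT -(card_isog (isog_subg A)) -(ltn_pmul2l (isT : 0 < 2)) cA.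
  case: (p) pM => // q; rewrite ltnS => Mq; rewrite factS mulnC.
  apply: (@leq_trans (q.+1 * 2)).
    by rewrite ltn_pmul2r // ltnS (leq_trans (leq_addr 5 M)).
  rewrite leq_pmul2l //; apply: leq_trans (fact_geq q).
  by apply: leq_trans Mq; rewrite addnS ltnS addnS.
- by rewrite -(isog_simple (isog_subg A)).
- by rewrite -(isog_abelian (isog_subg A)).
- have [a [b abA]] : exists a b : {perm T}, <<[set a; b]>> = 'Alt_T.
    by apply: Alt_2generated; rewrite ?cT.
  have [aA bA] : a \in A /\ b \in A.
    by rewrite /A /= -abA !mem_gen ?set21 ?set22.
  exists (subg A a), (subg A b).
  transitivity (subg A @* <<[set a; b]>>); last by rewrite abA -(im_subg A).
  rewrite morphim_gen; last by apply/subsetP=> z /set2P[] ->.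
  by rewrite morphimU !morphim_set1.
have [c [d [sylc cA' dA cdc cdnc]]] := Alt_Sylow_cycle pp p5.
move=> beta; apply: (@no_transitive_twist _ p (subg A c) (subg A d)).
- have -> : <[subg A c]> = subg A @* <[c]> by rewrite morphim_cycle.
  by rewrite -(im_subg A) injm_pHall ?injm_subg ?cycle_subG.
- rewrite -morphJ //= -(morphim_cycle (subg_morphism A)) //.
  by apply: mem_morphim => //; rewrite memJ_norm // (subsetP (normG _)).
rewrite -morphJ //; apply: contra cdnc => /eqP.
by move/(can_in_inj (@subgK _ A)) => -> //; rewrite groupJ.
Qed.

(** * Separating twisted classes *)

Section Morph.
Variables (G H : groupType) (f : G -> H).
Hypothesis fM : {morph f : x y / x * y}.

Lemma morph_one : f 1 = 1.
Proof. by apply: (mulgI (f 1)); rewrite -fM !mulg1. Qed.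

Lemma morph_inv : {morph f : x / x^-1}.
Proof. by move=> x; apply/esym/mulg1_eq; rewrite -fM mulgV morph_one. Qed.

End Morph.

Definition is_subgroup (G : groupType) (N : G -> Prop) :=
  N 1 /\ forall x y, N x -> N y -> N (x * y^-1).

Section Subgroup.
Variables (G : groupType) (N : G -> Prop).
Hypothesis sgN : is_subgroup N.

Lemma is_subgroup1 : N 1. Proof. by case: sgN. Qed.

Lemma is_subgroupV x : N x -> N x^-1.
Proof. by move=> Nx; rewrite -[_^-1]mul1g; apply: sgN.2 => //; case: sgN. Qed.

Lemma is_subgroupM x y : N x -> N y -> N (x * y).
Proof. by move=> Nx Ny; rewrite -[y]invgK; apply: sgN.2 => //; apply: is_subgroupV. Qed.

Lemma is_subgroupJ x y : N x -> N y -> N (x ^ y).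
Proof.
move=> Nx Ny; apply: is_subgroupM; first exact: is_subgroupV.
exact: is_subgroupM.
Qed.

Variables (H : groupType) (f : G -> H).
Hypothesis fM : forall x y, N x -> N y -> f (x * y) = f x * f y.

Lemma subgroup_morph1 : f 1 = 1.
Proof. by apply: (mulgI (f 1)); rewrite -fM ?mulg1 //; apply: is_subgroup1. Qed.

Lemma subgroup_morphV x : N x -> f x^-1 = (f x)^-1.
Proof.
move=> Nx; apply/esym/mulg1_eq.
by rewrite -fM ?mulgV ?subgroup_morph1 //; apply: is_subgroupV.
Qed.

Lemma subgroup_morphJ x y : N x -> N y -> f (x ^ y) = f x ^ f y.
Proof.
have [NV NM] := (is_subgroupV, is_subgroupM).
by move=> Nx Ny; rewrite !conjgE !fM ?subgroup_morphV //; auto.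
Qed.

Lemma subgroup_morphR x y : N x -> N y -> f [~ x, y] = [~ f x, f y].
Proof.
move=> Nx Ny; rewrite !commgEl fM ?subgroup_morphV ?subgroup_morphJ //.
- exact: is_subgroupV.
- exact: is_subgroupJ.
Qed.

End Subgroup.

Definition normal_in (G : groupType) (D N : G -> Prop) :=
  is_subgroup N /\ forall x g, N x -> D g -> N (x ^ g).

(** The image of [N] is normal because [f] maps [D] onto [Q]; simplicity leaves only the trivial
    group and [Q]. *)
Lemma normal_image_full (G : groupType) (Q : finGroupType) (D N : G -> Prop)
    (f : G -> Q) :
  is_subgroup D -> (forall x y, D x -> D y -> f (x * y) = f x * f y) ->
  (forall q, exists2 x, D x & f x = q) -> simple [set: Q] ->
  normal_in D N -> (forall x, N x -> D x) -> (exists2 x, N x & f x != 1) ->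
  forall q, exists2 x, N x & f x = q.
Proof.
move=> sgD fM onto smp [sgN nN] ND [x0 Nx0 fx0].
pose I := [set q | `[< exists2 x, N x & f x = q >]].
have II q : q \in I <-> exists2 x, N x & f x = q.
  by rewrite inE; split => [/asboolP|?]; last exact/asboolP.
have gI : group_set I.
  apply/group_setP; split=> [|a b /II[x Nx <-] /II[y Ny <-]]; apply/II.
    by exists 1; [exact: is_subgroup1 | exact: subgroup_morph1 fM].
  by exists (x * y); [exact: is_subgroupM | apply: fM; apply: ND].
pose J := Group gI.
have nJ : J <| [set: Q].
  apply/andP; split; first exact: subsetT.
  apply/subsetP=> q _; apply/normP/eqP; rewrite eqEcard cardJg leqnn andbT.
  apply/subsetP=> _ /imsetP[a /II[x Nx <-] ->]; apply/II.
  have [y Dy <-] := onto q; exists (x ^ y); first exact: nN.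
  by apply: (subgroup_morphJ sgD fM); first exact: ND.
have /simpleP[_ /(_ J nJ)[J1|JT]] := smp.
  have : f x0 \in J by apply/II; exists x0.
  by rewrite J1 => /set1gP fx1; rewrite fx1 eqxx in fx0.
by move=> q; apply/II; rewrite -[I]/(gval J) JT.
Qed.

Section Separate.
Variables (G : groupType) (phi : G -> G).
Hypotheses (phiM : {morph phi : x y / x * y}) (phi_bij : bijective phi).

Lemma iter_morph k : {morph iter k phi : x y / x * y}.
Proof. by elim: k => // k IH x y; rewrite !iterS IH phiM. Qed.

(** The G-component of the k-th power of (x, phi) in the semidirect product of G by <phi>. *)
Definition twisted_norm k x := \prod_(i < k) iter i phi x.

Lemma twisted_normS k x : twisted_norm k.+1 x = twisted_norm k x * iter k phi x.
Proof. by rewrite /twisted_norm big_ord_recr. Qed.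

(** The inner factors telescope, so that twisting by [phi] becomes twisting by phi^k. *)
Lemma twisted_norm_conj k g x :
  twisted_norm k (g * x * (phi g)^-1) = g * twisted_norm k x * (iter k phi g)^-1.
Proof.
have itV j y : iter j phi y^-1 = (iter j phi y)^-1.
  by elim: j => // j IH; rewrite !iterS IH (morph_inv phiM).
elim: k => [|k IH]; first by rewrite /twisted_norm !big_ord0 mulg1 mulgV.
rewrite !twisted_normS IH !iter_morph itV -iterSr !mulgA.
by rewrite mulgVK.
Qed.


Variables (D F N : G -> Prop) (Q : finGroupType) (T : finType).
Variables (f : G -> Q) (kappa : G -> T) (k0 : nat).
Hypotheses (sgD : is_subgroup D) (nF : normal_in D F) (nN : normal_in D N).
Hypotheses (FD : forall x, F x -> D x) (NF : forall x, N x -> F x).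
Hypotheses (phiF : forall x, F (phi x) <-> F x).
Hypotheses (fM : forall x y, D x -> D y -> f (x * y) = f x * f y).
Hypotheses (onto : forall q, exists2 x, D x & f x = q).
Hypotheses (smpQ : simple [set: Q]) (nabQ : ~~ abelian [set: Q]).
Hypothesis twistQ : forall beta : {morphism [set: Q] >-> Q}, 'injm beta ->
  exists s, forall u, s != beta u * u^-1.
Hypothesis kappaN : forall x y, kappa x = kappa y -> N (x * y^-1).
Hypothesis ltTQ : #|T| < #|Q|.
Hypotheses (k0_gt0 : 0 < k0).
Hypothesis fk0 : forall x, F x -> f (iter k0 phi x) = f x.

Let sgF : is_subgroup F := nF.1.
Let sgN : is_subgroup N := nN.1.

Let fMF x y : F x -> F y -> f (x * y) = f x * f y.
Proof. by move=> /FD Dx /FD; apply: fM. Qed.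

Let iterF k x : F (iter k phi x) <-> F x.
Proof. by elim: k => // k IH; rewrite iterS; split=> [/phiF/IH|/IH/phiF]. Qed.

Let iterF_surj k x : F x -> exists2 y, F y & iter k phi y = x.
Proof.
case: phi_bij => psi _ phiK; elim: k x => [|k IH] x Fx; first by exists x.
have [|y Fy yx] := IH (psi x); first by apply/phiF; rewrite phiK.
by exists y => //; rewrite iterS yx phiK.
Qed.

(** If [f] were trivial on [N], elements with equal labels under [kappa] would have equal images,
    and there are fewer labels than elements of [Q]. *)
Let ontoN q : exists2 x, N x & f x = q.
Proof.
apply: (normal_image_full sgD fM onto smpQ nN) => [x /NF/FD //|].
apply: contrapT => triv.
have /choice[r rP] q' : exists x, D x /\ f x = q'.
  by have [x] := onto q'; exists x.
suff /leq_card : injective (kappa \o r) by rewrite leqNgt ltTQ.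
move=> a b /kappaN rab.
have /eqP : f (r a * (r b)^-1) = 1.
  by apply: contrapT => /eqP nz; apply: triv; exists (r a * (r b)^-1).
have [[Da fa] [Db fb]] := (rP a, rP b).
have DV := is_subgroupV sgD Db.
rewrite fM ?(subgroup_morphV sgD fM) ?fa ?fb //.
by rewrite divg_eq1 => /eqP.
Qed.

(** Only the inclusion of ker (f o phi^k) in ker f; equality follows for finite [Q], both maps being
    onto. *)
Let kernel_le k := `[< forall x, F x -> f (iter k phi x) = 1 -> f x = 1 >].

Let kernel_lt l : ~~ kernel_le l ->
  exists2 x, F x & f (iter l phi x) = 1 /\ f x != 1.
Proof.
move=> /asboolPn nle; apply: contrapT => none; apply: nle => x Fx fx.
by apply: contrapT => /eqP nz; apply: none; exists x.
Qed.

Let fiM l x y : F x -> F y ->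
  f (iter l phi (x * y)) = f (iter l phi x) * f (iter l phi y).
Proof. by move=> Fx Fy; rewrite iter_morph fMF //; exact/iterF. Qed.

Let fiV l x : F x -> f (iter l phi x^-1) = (f (iter l phi x))^-1.
Proof. exact: (subgroup_morphV sgF (fiM l)). Qed.

(* Chinese remainder: distinct kernels of maps onto a nonabelian simple group
   are independent. *)
Let independent k L : (forall l, 0 < l < k -> ~~ kernel_le l) -> L < k ->
  forall q, exists2 x,
    N x /\ (forall l, 0 < l <= L -> f (iter l phi x) = 1) & f x = q.
Proof.
move=> nle; elim: L => [|L IH] Lk.
  by move=> q; have [x Nx fx] := ontoN q; exists x => //; split=> // -[].
have {}IH := IH (ltnW Lk).
pose K x := F x /\ f (iter L.+1 phi x) = 1.
have nK : normal_in F K.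
  split; first split.
  - by split; [exact: is_subgroup1|exact: (subgroup_morph1 sgF (fiM _))].
  - move=> x y [Fx fx] [Fy fy]; split; first exact: sgF.2.
    by rewrite fiM ?fiV ?fx ?fy ?invg1 ?mulg1 //; apply: is_subgroupV.
  move=> x g [Fx fx] Fg; split; first exact: is_subgroupJ.
  by rewrite (subgroup_morphJ sgF (fiM _)) // fx conj1g.
have ontoF q : exists2 x, F x & f x = q.
  by have [x /NF] := ontoN q; exists x.
have ontoK : forall q, exists2 x, K x & f x = q.
  apply: (normal_image_full sgF fMF ontoF smpQ nK) => [x []//|].
  by have [|x Fx [fx nz]] := kernel_lt (nle L.+1 _); [rewrite Lk | exists x].
pose M x := N x /\ (forall l, 0 < l <= L.+1 -> f (iter l phi x) = 1).
have nM : normal_in F M.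
  split; first split.
  - split=> [|l _]; first exact: is_subgroup1.
    exact: (subgroup_morph1 sgF (fiM _)).
  - move=> x y [Nx fx] [Ny fy]; split=> [|l lL]; first exact: sgN.2.
    rewrite fiM ?fiV ?fx ?fy ?invg1 ?mulg1 //; try exact: NF.
    by apply: is_subgroupV => //; apply: NF.
  move=> x g [Nx fx] Fg; split=> [|l lL]; first exact: (nN.2 _ _ Nx (FD Fg)).
  by rewrite (subgroup_morphJ sgF (fiM _)) ?fx ?conj1g //; apply: NF.
suff : forall q, exists2 x, M x & f x = q by [].
apply: (normal_image_full sgF fMF ontoF smpQ nM) => [x [/NF]//|].
have [a [b nab]] : exists a b : Q, [~ a, b] != 1.
  apply: contrapT => com; move/negP: nabQ; apply; apply/centsP=> a _ b _.
  by apply/commgP; apply: contrapT => /negP ab; apply: com; exists a, b.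
(* [x] takes care of the exponents up to [L] and [y] of L + 1. Their commutator lies in all these
   kernels, while [f] sends it to [~ a, b], which is nontrivial. *)
have [x [Nx fx] fxa] := IH a; have [y [Fy fy] fyb] := ontoK b.
have Fx := NF Nx.
exists [~ x, y]; last by rewrite (subgroup_morphR sgF fMF) // fxa fyb.
split=> [|l /andP[l0]].
  rewrite commgEl; apply: is_subgroupM => //; first exact: is_subgroupV.
  by apply: nN.2 => //; apply: FD.
rewrite (subgroup_morphR sgF (fiM _)) // leq_eqVlt ltnS => /predU1P[->|lL].
  by rewrite fy commg1.
by rewrite fx ?l0 // comm1g.
Qed.

Lemma separating_element : exists2 x, N x &
  exists k, forall y, N y -> (forall l, l < k -> f (iter l phi y) = 1) ->
    forall g, F g -> x <> g * y * (phi g)^-1.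
Proof.
have : exists k, (0 < k) && kernel_le k.
  exists k0; rewrite k0_gt0; apply/asboolP=> x Fx; by rewrite fk0.
case/ex_minnP=> k /andP[k_gt0 /asboolP le_k] kmin.
have nle l : 0 < l < k -> ~~ kernel_le l.
  by case/andP=> l0 lk; apply/negP=> le_l; have := kmin l; rewrite l0 le_l leqNgt lk => /(_ isT).
have ontoF q : exists2 x, F x & f (iter k phi x) = q.
  have [x /NF/(iterF_surj k)[y Fy <-] fx] := ontoN q; by exists y.
have /choice[r rP] q : exists x, F x /\ f (iter k phi x) = q.
  by have [x] := ontoF q; exists x.
(* By [le_k], f x depends only on f (phi^k x); [beta] is the resulting map. *)
pose beta q := f (r q).
have betaE x : F x -> beta (f (iter k phi x)) = f x.
  move=> Fx; have [Fr fr] := rP (f (iter k phi x)).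
  have Frx : F (r (f (iter k phi x)) * x^-1) by exact: sgF.2.
  have FxV := is_subgroupV sgF Fx.
  apply/eqP; rewrite /beta -divg_eq1 -(subgroup_morphV sgF fMF) // -fMF //.
  by apply/eqP/le_k => //; rewrite fiM // fiV // fr mulgV.
have betaM : {in [set: Q] &, {morph beta : a b / a * b}}.
  move=> a b _ _; have [[Fa <-] [Fb <-]] := (rP a, rP b).
  by rewrite -fiM // !betaE // ?fMF //; exact: is_subgroupM.
pose betam := Morphism betaM.
(* [betam] is onto because [f] is, hence injective on the finite group [Q]. *)
have injb : 'injm betam.
  rewrite -card_im_injm; apply/eqP; congr #|pred_of_set _|.
  apply/setP=> q; rewrite inE; have [x /NF Fx <-] := ontoN q.
  by apply/morphimP; exists (f (iter k phi x)); rewrite ?inE //= betaE.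
have [s sP] := twistQ injb.
have k1 : k.-1 < k by rewrite prednK.
have [x [Nx fx] fxs] := independent nle k1 s.
exists x => //; exists k => y Ny fy g Fg xE.
have [Fx Fy] := (NF Nx, NF Ny).
have normF j z : F z -> F (twisted_norm j z).
  move=> Fz; elim: j => [|j IH]; first by rewrite /twisted_norm big_ord0; exact: is_subgroup1.
  by rewrite twisted_normS; apply: is_subgroupM => //; exact/iterF.
(* Only the factor of index 0 contributes. *)
have norm_x j : 0 < j <= k -> f (twisted_norm j x) = s.
  elim: j => // -[|j] IH lejk; first by rewrite /twisted_norm big_ord1.
  rewrite twisted_normS fMF ?IH ?fx ?mulg1 //; try exact: normF; try exact/iterF.
  - by rewrite /= -ltnS prednK.
  - by rewrite /= ltnW.
have norm_y j : j <= k -> f (twisted_norm j y) = 1.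
  elim: j => [|j IH] jk; first by rewrite /twisted_norm big_ord0 (subgroup_morph1 sgF fMF).
  rewrite twisted_normS fMF ?IH ?fy ?mulg1 //; try exact: normF; try exact/iterF.
  exact: ltnW.
(* Taking norms in x = g * y * (phi g)^-1 and applying [f] gives s = beta u * u^-1 with u = f (phi^k
   g). *)
have := norm_x k; rewrite k_gt0 leqnn => /(_ isT).
have Fkg : F (iter k phi g) by exact/iterF.
have FkgV := is_subgroupV sgF Fkg.
rewrite xE twisted_norm_conj fMF ?fMF ?norm_y ?mulg1 ?(subgroup_morphV sgF fMF) //.
- move=> es; have := sP (f (iter k phi g)).
  by rewrite /= betaE // es eqxx.
- exact: normF.
- by apply: is_subgroupM => //; apply: normF.
Qed.
End Separate.

(** Equal labels force equal right cosets, but a coset may carry several labels; intersections are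
    then handled by pairing labels. *)
Definition finite_index (G : groupType) (F : G -> Prop) :=
  exists (T : finType) (kappa : G -> T),
    forall x y, kappa x = kappa y -> F (x * y^-1).

(** Write the twisting element as h * c with [h] in [F] and [c] from a finite list of coset
    representatives, and absorb [c] into the class representative. *)
Lemma finite_twisted_reps (G : groupType) (phi : G -> G) (F : G -> Prop) :
  {morph phi : x y / x * y} -> finite_index F ->
  cardinality.finite_set (classical_sets.range (twisted_class phi)) ->
  exists s : seq G, forall x, exists2 a, a \in s &
    exists2 h, F h & x = h * a * (phi h)^-1.
Proof.
move=> phiM [T [kappa kappaF]] /cardinality.finite_seqP[cs csE].
have phiV := morph_inv phiM.
have [L LP] : exists L : seq G, forall x, twisted_class phi x \in cs ->
    exists2 a, a \in L & twisted_class phi a = twisted_class phi x.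
  elim: cs {csE} => [|C cs [L LP]]; first by exists [::].
  have [[c cC]|noC] := pselect (exists c, twisted_class phi c = C).
    exists (c :: L) => x; rewrite inE => /predU1P[->|/LP[a aL aE]].
      by exists c; rewrite ?mem_head.
    by exists a; rewrite // inE aL orbT.
  exists L => x; rewrite inE => /predU1P[xC|/LP//].
  by case: noC; exists x.
(* Labels that are not attained receive the default 1. *)
have /choice[c cP] (t : T) : exists c, (exists g, kappa g = t) -> kappa c = t.
  by have [[g gt]|no] := pselect (exists g, kappa g = t); [exists g|exists 1].
exists [seq c t * a * (phi (c t))^-1 | t <- enum T, a <- L] => x.
have [a aL ax] : exists2 a, a \in L & twisted_class phi a = twisted_class phi x.
  apply: LP; have : classical_sets.range (twisted_class phi) (twisted_class phi x).
    by exists x.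
  by rewrite csE.
have [g ->] : twisted_class phi a x.
  by rewrite ax; exists 1; rewrite (morph_one phiM) divg1 mul1g.
pose t := kappa g.
have ct : kappa (c t) = t by apply: cP; exists g.
exists (c t * a * (phi (c t))^-1); first by apply: allpairs_f; rewrite ?mem_enum.
exists (g * (c t)^-1); first by apply: kappaF.
by rewrite phiM phiV invgM invgK !mulgA !mulgVK.
Qed.

(* A subgroup N of finite index always contains an element whose class misses
   a smaller subgroup N' of finite index; representatives of the classes
   meeting N thus get lost on passing to N'. *)
Lemma infinite_twisted_classes (G : groupType) (phi : G -> G) (F : G -> Prop) :
  {morph phi : x y / x * y} -> bijective phi ->
  normal_in (fun=> True) F -> finite_index F -> (forall x, F (phi x) <-> F x) ->
  (forall M, exists (Q E : finGroupType) (D : G -> Prop) (f : G -> Q) (Psi : G -> E),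
    [/\ M < #|Q|, simple [set: Q], ~~ abelian [set: Q] &
        forall beta : {morphism [set: Q] >-> Q}, 'injm beta ->
          exists s, forall u, s != beta u * u^-1] /\
    [/\ is_subgroup D, forall x, F x -> D x,
        forall x y, D x -> D y -> f (x * y) = f x * f y &
        forall q, exists2 x, D x & f x = q] /\
    [/\ {morph Psi : x y / x * y}, forall x y, Psi x = Psi y -> f x = f y &
        exists2 k, 0 < k & forall x, Psi (iter k phi x) = Psi x]) ->
  cardinality.infinite_set (classical_sets.range (twisted_class phi)).
Proof.
move=> phiM phi_bij nF fiF phiF fam /(finite_twisted_reps phiM fiF)[s sP].
suff no_reps (n : nat) (r : seq G) (N : G -> Prop) : size r = n ->
    normal_in (fun=> True) N -> finite_index N -> (forall x, N x -> F x) ->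
    ~ forall x, N x -> exists2 a, a \in r &
      exists2 h, F h & x = h * a * (phi h)^-1.
  by apply: (no_reps (size s) s F) => // x _.
elim: n r N => [|n IH] r N sr nN fiN NF rP.
  have [a] := rP 1 (is_subgroup1 nN.1); by rewrite (size0nil sr).
have [T [kappa kappaN]] := fiN.
(* [Q] is chosen larger than the number of labels for [N], so that [f] stays onto on [N]. *)
have [Q [E [D [f [Psi [[ltTQ smp nab tw] [[sgD FD fM onto] [PsiM Psif [k0 k0_gt0 Psik0]]]]]]]]] := fam #|T|.
have nFD : normal_in D F by split; [exact: nF.1 | move=> x g Fx _; exact: nF.2].
have nND : normal_in D N by split; [exact: nN.1 | move=> x g Fx _; exact: nN.2].
have fk0 x : F x -> f (iter k0 phi x) = f x by move=> _; apply: Psif.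
have [x Nx [k xP]] := separating_element phiM phi_bij sgD nFD nND FD NF phiF fM
  onto smp nab tw kappaN ltTQ k0_gt0 fk0.
have [a ar [h Fh xE]] := rP x Nx.
(* [Psi] replaces [f] here: being a morphism on all of [G], it keeps [N'] normal and of finite
   index, and f is determined by it. *)
pose N' y := N y /\ forall l, l < k -> Psi (iter l phi y) = 1.
have itM l : {morph Psi \o iter l phi : u v / u * v}.
  by move=> u v /=; rewrite iter_morph // PsiM.
have itV l : {morph Psi \o iter l phi : u / u^-1} := morph_inv (itM l).
apply: (IH (rem a r) N').
- by rewrite size_rem // sr.
- split; first split.
  + by split=> [|l _]; [exact: is_subgroup1 nN.1 | exact: (morph_one (itM l))].
  + move=> u v [Nu Pu] [Nv Pv]; split=> [|l lk]; first exact: nN.1.2.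
    by rewrite [LHS]itM [X in _ * X]itV /= Pu // Pv // mulgV.
  move=> u g [Nu Pu] _; split=> [|l lk]; first exact: nN.2.
  by rewrite conjgE [LHS]itM [X in _ * X]itM itV /= Pu // mul1g mulVg.
- exists (T * {ffun 'I_k -> E})%type, (fun u => (kappa u, [ffun l : 'I_k => Psi (iter l phi u)])).
  move=> u v [/kappaN Nuv /ffunP uv]; split=> // l lk.
  have := uv (Ordinal lk); rewrite !ffunE /= => uvl.
  by rewrite [LHS]itM [X in _ * X]itV /= uvl mulgV.
- by move=> u [/NF].
(* If [y] had the same representative [a] as [x], then x would be a twist of [y] by h * g^-1,
   against [xP]; so [a] can be removed. *)
move=> y [Ny Py]; have [b br [g Fg yE]] := rP y Ny.
exists b; last by exists g.
have := perm_mem (perm_to_rem ar) b; rewrite br inE => /esym/predU1P[ba|//].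
have := xP y Ny; case/(_ _ (h * g^-1)).
- by move=> l /Py; rewrite -(morph_one PsiM) => /Psif ->; exact: (subgroup_morph1 sgD fM).
- by apply: nF.1.2.
by rewrite xE yE ba phiM (morph_inv phiM) invgM invgK !mulgA !mulgVK.
Qed.

(** * Maps out of the star-shaped Coxeter group *)

Section StarCoxeter.
Variables (n : nat) (m : 'I_n -> nat).
Let W := star_coxeter m.

Definition star_gen (i : 'I_n.+1) : W := class_of_word (star_relators m) [:: (i, true)].

Lemma class_of_word_cat u v : class_of_word (star_relators m) (u ++ v) =
  (class_of_word (star_relators m) u : W) * (class_of_word (star_relators m) v : W).
Proof. by rewrite -pg_mulE. Qed.

Lemma class_of_relator r : star_relators m r ->
  class_of_word (star_relators m) r = (1 : W).
Proof.
by move=> Rr; apply/class_of_wordP; have := weq_rel [::] [::] Rr; rewrite /= cats0.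
Qed.

Lemma star_gen_sq i : star_gen i * star_gen i = 1.
Proof.
by rewrite -class_of_word_cat; apply: class_of_relator; left; exists i.
Qed.

Lemma star_genV i : (star_gen i)^-1 = star_gen i.
Proof. exact/mulg1_eq/star_gen_sq. Qed.

Lemma star_gen_rel (j : 'I_n) : (star_gen ord0 * star_gen (lift ord0 j)) ^+ m j = 1.
Proof.
transitivity (class_of_word (star_relators m)
  (flatten (nseq (m j) [:: (ord0, true); (lift ord0 j, true)])) : W).
  elim: (m j) => //= k IH; rewrite expgS IH.
  rewrite -mulgA (class_of_word_cat [:: (ord0, true)]).
  by rewrite (class_of_word_cat [:: (lift ord0 j, true)]).
by apply: class_of_relator; right; exists j.
Qed.

Lemma star_ind (P : W -> Prop) :
  P 1 -> (forall i g, P g -> P (star_gen i * g)) -> forall g, P g.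
Proof.
move=> P1 Pg g; rewrite -(class_of_wordK g); elim: (generic_quotient.repr g) => [|[i b] w IH] //.
rewrite -cat1s class_of_word_cat.
suff -> : class_of_word (star_relators m) [:: (i, b)] = star_gen i by exact: Pg.
case: b => //; rewrite -[RHS]star_genV; apply/esym/mulg1_eq.
rewrite /star_gen -class_of_word_cat; apply/class_of_wordP.
exact: (weq_cancel _ [::] [::] (i, true)).
Qed.

Lemma star_morph_ext (H : groupType) (f g : W -> H) :
  {morph f : x y / x * y} -> {morph g : x y / x * y} ->
  (forall i, f (star_gen i) = g (star_gen i)) -> f =1 g.
Proof.
move=> fM gM fg; apply: star_ind; first by rewrite !morph_one.
by move=> i x fgx; rewrite fM gM fg fgx.
Qed.

Lemma star_morph_exists (H : groupType) (gam : 'I_n.+1 -> H) :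
  (forall i, gam i * gam i = 1) ->
  (forall j, (gam ord0 * gam (lift ord0 j)) ^+ m j = 1) ->
  exists2 f : W -> H, {morph f : x y / x * y} & forall i, f (star_gen i) = gam i.
Proof.
(* Signs of letters are ignored, each [gam i] being its own inverse. *)
move=> gam_sq gam_rel; pose ev (w : word 'I_n.+1) := foldr (fun a h => gam a.1 * h) 1 w.
have ev_cat u v : ev (u ++ v) = ev u * ev v.
  by elim: u => [|a u IH] /=; rewrite ?mul1g // IH mulgA.
have ev_eq u v : word_eq (star_relators m) u v -> ev u = ev v.
  elim=> {u v} [//|u v _ -> //|u v w _ -> _ -> //|u v a|u v r Rr].
    by rewrite !ev_cat /= mulg1 gam_sq mul1g.
  rewrite !ev_cat; suff -> : ev r = 1 by rewrite mul1g.
  case: Rr => [[i ->]|[j ->]]; first by rewrite /= mulg1.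
  rewrite -(gam_rel j); elim: (m j) => //= k IH.
  by rewrite IH expgS mulgA.
pose f (x : W) := ev (generic_quotient.repr x).
have fE w : f (class_of_word (star_relators m) w) = ev w.
  exact/ev_eq/Defs.repr_class.
exists f => [x y|i]; last by rewrite fE /= mulg1.
by rewrite -(class_of_wordK x) -(class_of_wordK y) -class_of_word_cat !fE ev_cat.
Qed.

End StarCoxeter.

(** * Actions with prescribed holonomy *)

Section StarFinite.
Variables (n : nat) (m : 'I_n -> nat) (E : finGroupType).
Let W := star_coxeter m.

(** Morphisms to [E] are determined by the images of the generators, so two of the maps Psi o phi^l
    agree; surjectivity of [phi] cancels the smaller exponent. *)
Lemma star_morph_periodic (phi : W -> W) (Psi : W -> E) :
  {morph phi : x y / x * y} -> bijective phi -> {morph Psi : x y / x * y} ->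
  exists2 k, 0 < k & forall x, Psi (iter k phi x) = Psi x.
Proof.
move=> phiM [psi phiK psiK] PsiM.
pose trace (l : 'I_(#|{: {ffun 'I_n.+1 -> E}}|.+1)) :=
  [ffun i => Psi (iter l phi (star_gen m i))].
have [a [b [ab tab]]] : exists a b : 'I_(#|{: {ffun 'I_n.+1 -> E}}|.+1),
    a < b /\ trace a = trace b.
  apply: contrapT => none; suff /leq_card : injective trace by rewrite card_ord ltnn.
  move=> a b tab; apply/val_inj; case: (ltngtP a b) => // ltab; case: none.
    by exists a, b.
  by exists b, a.
have eq_iter x : Psi (iter a phi x) = Psi (iter b phi x).
  apply: (star_morph_ext (f := Psi \o iter a phi) (g := Psi \o iter b phi)).
  - by move=> u v /=; rewrite iter_morph // PsiM.
  - by move=> u v /=; rewrite iter_morph // PsiM.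
  by move=> i; have /ffunP/(_ i) := tab; rewrite !ffunE.
exists (b - a); first by rewrite subn_gt0.
have surj k y : exists x, iter k phi x = y.
  elim: k y => [|k IH] y; first by exists y.
  by have [x xE] := IH (psi y); exists x; rewrite iterS xE psiK.
by move=> y; have [x <-] := surj a y; rewrite -iterD subnK ?(ltnW ab) //.
Qed.

(** The common kernel of all morphisms to [E]: automorphisms permute these morphisms, and there are
    finitely many of them. It serves as the subgroup F of the main argument. *)
Definition finite_residual (x : W) :=
  forall h : W -> E, {morph h : x y / x * y} -> h x = 1.

Lemma finite_residual_normal : normal_in (fun=> True) finite_residual.
Proof.
split; first split; first by move=> h hM; exact: morph_one.
  by move=> x y Fx Fy h hM; rewrite hM (morph_inv hM) Fx // Fy // mulgV.
move=> x g Fx _ h hM; rewrite conjgE !hM (morph_inv hM) Fx //.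
by rewrite mul1g mulVg.
Qed.

Lemma finite_residual_index : finite_index finite_residual.
Proof.
(* Tuples that do not extend to a morphism receive the constant map 1. *)
have /choice[h hP] (gam : {ffun 'I_n.+1 -> E}) : exists h : W -> E,
    (exists h' : W -> E, {morph h' : x y / x * y} /\ forall i, h' (star_gen m i) = gam i) ->
    {morph h : x y / x * y} /\ forall i, h (star_gen m i) = gam i.
  have [[h' h'P]|no] := pselect (exists h' : W -> E,
    {morph h' : x y / x * y} /\ forall i, h' (star_gen m i) = gam i).
    by exists h'.
  by exists (fun=> 1) => /no.
exists {ffun {ffun 'I_n.+1 -> E} -> E}, (fun x => [ffun gam => h gam x]).
move=> x y /ffunP xy h' h'M; pose gam := [ffun i => h' (star_gen m i)].
have [hM hE] : {morph h gam : x y / x * y} /\ forall i, h gam (star_gen m i) = gam i.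
  by apply: hP; exists h'; split=> // i; rewrite ffunE.
have h'E : h' =1 h gam by apply: star_morph_ext => // i; rewrite hE ffunE.
by have := xy gam; rewrite !ffunE h'M (morph_inv h'M) !h'E => ->; rewrite mulgV.
Qed.

Lemma finite_residual_stable (phi : W -> W) :
  {morph phi : x y / x * y} -> bijective phi ->
  forall x, finite_residual (phi x) <-> finite_residual x.
Proof.
move=> phiM [psi phiK psiK] x; split=> Fx h hM.
  have := Fx (h \o psi); rewrite /= phiK; apply=> u v /=.
  by rewrite -hM; congr h; apply: (can_inj phiK); rewrite phiM !psiK.
by apply: (Fx (h \o phi)) => u v /=; rewrite phiM hM.
Qed.

End StarFinite.

Section Switch.
Variable X : finType.

(** Doubling [X] turns any permutation into an involution. With s_0 sent to [switch 1] and s_j to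
    [switch (p j)], the Coxeter relations only ask that p j ^+ m j = 1. *)
Definition switch_fun (p : {perm X}) (u : bool * X) :=
  (~~ u.1, if u.1 then p^-1 u.2 else p u.2).

Lemma switch_funK p : involutive (switch_fun p).
Proof. by case=> [[] x]; rewrite /switch_fun /= ?permK ?permKV. Qed.

Definition switch p : {perm bool * X} := perm (can_inj (switch_funK p)).

Lemma switch_false p x : switch p (false, x) = (true, p x).
Proof. by rewrite permE. Qed.

Lemma switch_true p x : switch p (true, x) = (false, p^-1 x).
Proof. by rewrite permE. Qed.

Lemma switch_sq p : switch p * switch p = 1.
Proof. by apply/permP=> u; rewrite permM !permE switch_funK. Qed.

Lemma switch_rel p k : p ^+ k = 1 -> (switch 1 * switch p) ^+ k = 1.
Proof.
move=> pk; apply/permP=> -[e x]; rewrite perm1.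
have -> l : ((switch 1 * switch p) ^+ l) (e, x) =
    (e, if e then (p ^+ l) x else (p ^- l) x).
  elim: l => [|l IH]; first by rewrite invg1 !perm1; case: e.
  rewrite expgSr permM IH permM; case: e {IH}.
    by rewrite switch_true switch_false invg1 perm1 expgSr permM.
  by rewrite switch_false switch_true perm1 expgS invgM permM.
by rewrite pk invg1 perm1; case: e.
Qed.

End Switch.

Section Voltage.
Import GRing.Theory.
Local Open Scope ring_scope.
Variables (n : nat) (m : 'I_n -> nat) (V : finZmodType) (Q : finGroupType).
Variables (v : 'I_n -> V) (a : 'I_n -> V -> Q).
Let W := star_coxeter m.

Definition translation (w : V) : {perm V} := perm (addIr w).

Lemma translation0 : translation 0 = 1%g.
Proof. by apply/permP=> z; rewrite perm1 permE addr0. Qed.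

Lemma translationX w k : (translation w ^+ k)%g = translation (w *+ k).
Proof.
elim: k => [|k IH]; first by rewrite translation0.
by apply/permP=> z; rewrite expgSr permM IH !permE mulrSr addrA.
Qed.

Lemma translationV w : (translation w)^-1%g = translation (- w).
Proof.
by apply: mulg1_eq; apply/permP=> z; rewrite permM !permE addrK.
Qed.

(* The translation by w conjugated by the gauge transformation (z, x) |-> (z,
   x * b z). *)
Definition transport_fun (b : V -> Q) (w : V) (u : V * Q) : V * Q :=
  (u.1 + w, (u.2 * (b u.1)^-1 * b (u.1 + w)))%g.

Lemma transport_fun_inj b w : injective (transport_fun b w).
Proof.
by move=> [z x] [z' x'] [/addIr <- /mulIg/mulIg <-].
Qed.

Definition transport b w : {perm V * Q} := perm (@transport_fun_inj b w).

Lemma transportE b w z x :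
  transport b w (z, x) = (z + w, (x * (b z)^-1 * b (z + w)))%g.
Proof. by rewrite permE. Qed.

Lemma transport_transport b w w' :
  (transport b w * transport b w')%g = transport b (w + w').
Proof.
by apply/permP=> -[z x]; rewrite permM !transportE mulgK addrA.
Qed.

Lemma transport0 b : transport b 0 = 1%g.
Proof. by apply/permP=> -[z x]; rewrite transportE perm1 addr0 mulgVK. Qed.

Lemma transportV b w : (transport b w)^-1%g = transport b (- w).
Proof. by apply/mulg1_eq; rewrite transport_transport subrr transport0. Qed.

Lemma transportX b w k : (transport b w ^+ k)%g = transport b (w *+ k).
Proof.
elim: k => [|k IH]; first by rewrite transport0.
by rewrite expgSr IH transport_transport mulrSr.
Qed.

Definition gen_perm (X : finType) (p : 'I_n -> {perm X}) (i : 'I_n.+1) :=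
  if unlift ord0 i is Some j then switch (p j) else switch 1.

Lemma gen_perm_morph (X : finType) (p : 'I_n -> {perm X}) :
  (forall j, p j ^+ m j = 1)%g ->
  exists2 h : W -> {perm bool * X}, {morph h : x y / (x * y)%g} &
    forall i, h (star_gen m i) = gen_perm p i.
Proof.
move=> pm; apply: star_morph_exists => [i|j].
  by rewrite /gen_perm; case: unlift => *; apply: switch_sq.
by rewrite /gen_perm unlift_none liftK switch_rel.
Qed.

Variables (Psi : W -> {perm bool * (V * Q)}) (theta : W -> {perm bool * V}).
Hypotheses (PsiM : {morph Psi : x y / (x * y)%g})
  (thetaM : {morph theta : x y / (x * y)%g}).
Hypothesis Psi_gen : forall i,
  Psi (star_gen m i) = gen_perm (fun j => transport (a j) (v j)) i.
Hypothesis theta_gen : forall i,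
  theta (star_gen m i) = gen_perm (fun j => translation (v j)) i.

(** The action on V * Q covers the one on V and moves fibres by right multiplications, because the
    generators do. Hence the holonomy is a morphism on the stabiliser of a point of the base. *)
Lemma Psi_fiber g e z : exists q, forall x,
  Psi g (e, (z, x)) = ((theta g (e, z)).1, ((theta g (e, z)).2, (x * q)%g)).
Proof.
elim/star_ind: g e z => [|i g IH] e z.
  by exists 1%g => x; rewrite (morph_one PsiM) (morph_one thetaM) !perm1 mulg1.
have [q1 q1P] : exists q, forall x, Psi (star_gen m i) (e, (z, x)) =
    ((theta (star_gen m i) (e, z)).1, ((theta (star_gen m i) (e, z)).2, (x * q)%g)).
  rewrite Psi_gen theta_gen /gen_perm; case: unlift => [j|]; last first.
    exists 1%g => x.
    by case: e; rewrite ?switch_true ?switch_false ?invg1 !perm1 mulg1.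
  case: e.
    exists ((a j z)^-1 * a j (z - v j))%g => x.
    by rewrite !switch_true transportV transportE translationV permE mulgA.
  exists ((a j z)^-1 * a j (z + v j))%g => x.
  by rewrite !switch_false transportE permE mulgA.
rewrite thetaM permM.
case: (theta (star_gen m i) (e, z)) q1P => e' z' /= q1P.
have [q2 q2P] := IH e' z'; exists (q1 * q2)%g => x.
by rewrite PsiM permM q1P q2P mulgA.
Qed.

End Voltage.

Section LowerSheet.
Variables (n : nat) (m : 'I_n -> nat) (X : finType) (p : 'I_n -> {perm X}).
Variable Psi : star_coxeter m -> {perm bool * X}.
Hypotheses (PsiM : {morph Psi : x y / x * y})
  (Psi_gen : forall i, Psi (star_gen m i) = gen_perm p i).

Definition acts_as (g : star_coxeter m) (q : {perm X}) :=
  forall u, Psi g (false, u) = (false, q u).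

Lemma acts_asM g h q r : acts_as g q -> acts_as h r -> acts_as (g * h) (q * r).
Proof. by move=> gq hr u; rewrite PsiM !permM gq hr. Qed.

Lemma acts_asV g q : acts_as g q -> acts_as g^-1 q^-1.
Proof.
move=> gq u; rewrite (morph_inv PsiM); apply: (canLR (permK _)).
by rewrite gq permKV.
Qed.

Lemma acts_asX g q k : acts_as g q -> acts_as (g ^+ k) (q ^+ k).
Proof.
move=> gq; elim: k => [|k IH]; last by rewrite !expgS; apply: acts_asM.
by move=> u; rewrite (morph_one PsiM) !perm1.
Qed.

Lemma acts_as_rotation j :
  acts_as (star_gen m (lift ord0 j) * star_gen m ord0) (p j).
Proof.
move=> u; rewrite PsiM permM !Psi_gen /gen_perm liftK unlift_none.
by rewrite switch_false switch_true invg1 perm1.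
Qed.

End LowerSheet.

(** Two parallelograms at 0 share the side v j1 and have other sides [y2] and [y3]. The hypotheses
    make their far corners distinct from each other and from all other vertices, so the two
    holonomies can be prescribed independently. The case j2 = j3 is allowed. *)
Lemma star_R_infinity_voltage (n : nat) (m : 'I_n -> nat) (V : finZmodType)
    (v : 'I_n -> V) (j1 j2 j3 : 'I_n) (r2 r3 : nat) :
  (forall j, v j *+ m j = 0)%R -> j2 != j1 -> j3 != j1 ->
  (v j1 + v j2 *+ r2 \notin [:: 0; v j1; v j2 *+ r2; v j3 *+ r3])%R ->
  (v j1 + v j3 *+ r3 \notin [:: 0; v j1; v j2 *+ r2; v j3 *+ r3])%R ->
  (v j2 *+ r2 != v j3 *+ r3)%R ->
  R_infinity (star_coxeter m).
Proof.
move=> vm j21 j31; set y2 := (v j2 *+ r2)%R; set y3 := (v j3 *+ r3)%R.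
move=> nw2 nw3 y23 phi phi_bij.
have phiM : {morph phi : x y / x * y} by exact: gmulfM.
apply: (@infinite_twisted_classes _ phi (@finite_residual n m {perm bool * V})) => //.
- exact: finite_residual_normal.
- exact: finite_residual_index.
- exact: finite_residual_stable.
move=> M; have [Q [ltMQ smp nab [x2 [x3 gen_x]] tw]] := exists_no_transitive_twist M.
(* The gauge is trivial in direction [j1]; in the others it takes the generators [x2] and [x3] of
   [Q] at the far corners. *)
pose a j z := if j == j1 then 1 else
  if z == (v j1 + y2)%R then x2 else if z == (v j1 + y3)%R then x3 else 1 : Q.
have [Psi PsiM Psi_gen] := gen_perm_morph (m := m)
  (p := fun j => transport (a j) (v j)) (fun j => etrans (transportX _ _ _)
    (etrans (congr1 (transport (a j)) (vm j)) (transport0 _))).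
have [theta thetaM theta_gen] := gen_perm_morph (m := m)
  (p := fun j => translation (v j)) (fun j => etrans (translationX _ _)
    (etrans (congr1 (@translation V) (vm j)) (translation0 _))).
pose D g := theta g (false, 0%R) = (false, 0%R).
pose f g := (Psi g (false, (0%R, 1))).2.2.
have fiber g : D g -> forall x, Psi g (false, (0%R, x)) = (false, (0%R, x * f g)).
  move=> Dg x; have [q qP] := Psi_fiber PsiM thetaM Psi_gen theta_gen g false 0%R.
  by rewrite /f !qP Dg /= mul1g.
have sgD : is_subgroup D.
  split=> [|x y Dx Dy]; first by rewrite /D (morph_one thetaM) perm1.
  rewrite /D thetaM (morph_inv thetaM) permM Dx.
  by apply: (canLR (permK _)); rewrite Dy.
have fM x y : D x -> D y -> f (x * y) = f x * f y.
  by move=> Dx Dy; rewrite {1}/f PsiM permM fiber // mul1g fiber.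
exists Q, {perm bool * (V * Q)}, D, f, Psi; split; first by [].
split; last first.
  split=> // [x y|]; first by rewrite /f => ->.
  exact: star_morph_periodic.
split=> // [x Fx|].
  by rewrite /D (Fx theta) ?perm1.
pose I := [set q | `[< exists2 g, D g & f g = q >]].
have II q : q \in I <-> exists2 g, D g & f g = q.
  by rewrite inE; split => [/asboolP|?]; last exact/asboolP.
have gI : group_set I.
  apply/group_setP; split=> [|b c /II[x Dx <-] /II[y Dy <-]]; apply/II.
    by exists 1; [exact: is_subgroup1 | exact: subgroup_morph1 fM].
  by exists (x * y); [exact: is_subgroupM | apply: fM].
suff IT : [set: Q] \subset Group gI.
  by move=> q; apply/II/(subsetP IT); rewrite inE.
have commutator_in j r c : j != j1 ->
    a j 0%R = 1 -> a j (v j1) = 1 -> a j (v j *+ r)%R = 1 ->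
    a j (v j1 + v j *+ r)%R = c -> c \in I.
  move=> jj1 a0 a1 ar ac; apply/II.
  pose t j := star_gen m (lift ord0 j) * star_gen m ord0.
  (* Permutations compose from left to right: the loop visits 0, v j1, v j1 + v j *+ r, v j *+ r and
     0. *)
  pose g := t j1 * t j ^+ r * (t j1)^-1 * (t j ^+ r)^-1.
  have tP := acts_as_rotation PsiM Psi_gen.
  have gP : Psi g (false, (0%R, 1)) = (false, (0%R, c)).
    have -> := acts_asM PsiM (acts_asM PsiM (acts_asM PsiM (tP j1)
      (acts_asX PsiM r (tP j))) (acts_asV PsiM (tP j1)))
      (acts_asV PsiM (acts_asX PsiM r (tP j))).
    rewrite !permM transportX !transportV !transportE.
    have aj1 z : a j1 z = 1 by rewrite /a eqxx.
    rewrite !GRing.add0r !aj1 [(v j1 + _ - _)%R]GRing.addrAC GRing.subrr GRing.add0r GRing.subrr.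
    by rewrite a0 a1 ar ac !invg1 !mulg1 mul1g.
  have Dg : D g.
    have [q qP] := Psi_fiber PsiM thetaM Psi_gen theta_gen g false 0%R.
    have := qP 1; rewrite gP /D; by case: (theta g _) => e z /= [<- <- _].
  by exists g => //; rewrite /f gP.
have notin4 (w : V) : w \notin [:: 0%R; v j1; y2; y3] ->
    [&& 0%R != w, v j1 != w, y2 != w & y3 != w].
  by rewrite !inE !negb_or !(eq_sym w).
have /and4P[/negPf w0 /negPf w1 /negPf w2 /negPf w3] := notin4 _ nw2.
have /and4P[/negPf u0 /negPf u1 /negPf u2 /negPf u3] := notin4 _ nw3.
have n32 : ((v j1 + y3 == v j1 + y2) = false)%R.
  by rewrite (inj_eq (GRing.addrI _)) eq_sym (negPf y23).
rewrite -gen_x gen_subG; apply/subsetP=> _ /set2P[] ->.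
  by apply: (commutator_in j2 r2 x2) => //; rewrite /a (negPf j21) -/y2 ?eqxx ?w0 ?w1 ?w2 ?u0 ?u1 ?u2.
by apply: (commutator_in j3 r3 x3) => //; rewrite /a (negPf j31) -/y3 ?n32 ?eqxx ?w0 ?w1 ?w3 ?u0 ?u1 ?u3.
Qed.

(** * The case m = (2, 2) *)

Section Dihedral.
Variable m : 'I_2 -> nat.
Hypothesis m2 : forall j, m j = 2.
Let W := star_coxeter m.
Let s0 : W := star_gen m ord0.
Let s1 : W := star_gen m (lift ord0 ord0).
Let s2 : W := star_gen m (lift ord0 ord_max).
(* Locked so that mulgA does not see through t and tau. *)
Let t : W := locked (s1 * s2).
Let tau : W := locked (t * t).

Let tE : t = s1 * s2. Proof. by rewrite /t -lock. Qed.
Let tauE : tau = t * t. Proof. by rewrite /tau -lock. Qed.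

Let s0_comm j : commute s0 (star_gen m (lift ord0 j)).
Proof.
have := star_gen_rel m j; rewrite m2 expg2 => /mulg1_eq.
by rewrite invgM !star_genV => /esym.
Qed.

Lemma dihedral_tau_order k : tau ^+ k = 1 -> k = 0.
Proof.
(* Let s_0 act trivially and s_1, s_2 by the reflections -x and 1 - x; then [t] is x |-> x + 1. The
   modulus exceeds the exponent 2(k + 1) of [t]. *)
case: k => // k tauk; pose M := (2 * k.+1)%N.+1; pose X : finType := 'Z_M.
pose r1 : {perm X} := perm (@GRing.oppr_inj 'Z_M).
have inj2 : injective (fun x : 'Z_M => 1 - x)%R by move=> x y /GRing.addrI/GRing.oppr_inj.
pose r2 : {perm X} := perm inj2.
pose gam (i : 'I_3) : {perm X} := nth 1 [:: 1; r1; r2] i.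
have gam_sq i : gam i * gam i = 1.
  case: i => -[|[|[|//]]] ?; rewrite /gam /=; apply/permP=> x; rewrite permM !permE //=.
    by rewrite GRing.opprK.
  by rewrite GRing.opprB GRing.addrC GRing.subrK.
have [h hM hE] := star_morph_exists (m := m) gam_sq (fun j => etrans
   (congr1 (fun k => (gam ord0 * gam (lift ord0 j)) ^+ k) (m2 j))
   (etrans (congr1 (fun p => p ^+ 2) (mul1g (gam (lift ord0 j)))) (gam_sq _))).
have ht l x : (h (t ^+ l)) x = (x + l%:R)%R.
  elim: l x => [|l IH] x; first by rewrite (morph_one hM) perm1 GRing.addr0.
  rewrite expgSr hM permM IH tE hM permM !hE /gam /= !permE.
  by rewrite GRing.opprK GRing.addrC -GRing.addrA GRing.natr1.
have := ht (2 * k.+1)%N 0%R; rewrite expgnA expg2 -tauE tauk (morph_one hM) perm1 GRing.add0r.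
move/(congr1 (@nat_of_ord _)); rewrite val_Zp_nat // modn_small //.
Qed.

(** The cyclic group <tau>, with integer exponents written as differences a - b. *)
Definition tau_subgroup (x : W) := exists a b, x = tau ^+ a * tau ^- b.

Let commX a b : commute (tau ^+ a) (tau ^- b).
Proof. exact/commuteV/commuteX2. Qed.

Lemma tau_subgroupP : is_subgroup tau_subgroup.
Proof.
split; first by exists 0, 0; rewrite !expg0 invg1 mulg1.
move=> _ _ [a [b ->]] [c [d ->]]; exists (a + d), (c + b).
by rewrite invgM invgK !expgnDr invgM !mulgA -(mulgA _ _ (tau ^+ d)) -commX !mulgA.
Qed.

Lemma tau_subgroup_comm u w : tau_subgroup u -> tau_subgroup w -> commute u w.
Proof.
move=> [a [b ->]] [c [d ->]]; apply: commuteM; apply: commute_sym; apply: commuteM.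
- exact: commuteX2.
- exact: commX.
- by apply: commute_sym; apply: commX.
- by apply/commute_sym/commuteV/commute_sym/commuteV/commuteX2.
Qed.

Let s1J : s1 * t * s1 = t^-1.
Proof. by rewrite tE invgM !star_genV mulgA star_gen_sq mul1g. Qed.

Let s1_inv u : tau_subgroup u -> s1 * u = u^-1 * s1.
Proof.
have s1E x : x ^ s1 = s1 * x * s1 by rewrite conjgE star_genV mulgA.
have tauJ : tau ^ s1 = tau^-1 by rewrite tauE conjMg !s1E s1J -invgM.
move=> [a [b ->]]; apply: (canRL (mulgVK s1)).
rewrite star_genV -s1E conjMg conjVg !conjXg tauJ !expVgn invgK invgM invgK.
exact/commute_sym/commX.
Qed.

Let tF : commute t tau. Proof. by rewrite /commute tauE mulgA. Qed.

Let t_comm u : tau_subgroup u -> commute t u.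
Proof.
move=> [a [b ->]]; apply: commuteM; first exact: commuteX.
exact/commuteV/commuteX.
Qed.

Let s0_comm_t : commute s0 t. Proof. by rewrite tE; apply: commuteM; exact: s0_comm. Qed.

Let s0_comm_tau u : tau_subgroup u -> commute s0 u.
Proof.
move=> [a [b ->]]; have c : commute s0 tau by rewrite tauE; apply: commuteM; exact: s0_comm_t.
by apply: commuteM; [exact: commuteX | exact/commuteV/commuteX].
Qed.

Let tau_in : tau_subgroup tau.
Proof. by exists 1%N, 0; rewrite expg0 invg1 mulg1. Qed.

(** s_0 is central, s_1 inverts [t] and t^2 = tau. The elements of this form are thus stable under
    left multiplication by s_0, s_1 and [t], hence by s_2 = s_1 t. *)
Lemma tau_normal_form g : exists u (i e d : bool),
  tau_subgroup u /\ g = u * t ^+ i * s0 ^+ e * s1 ^+ d.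
Proof.
have sgT := tau_subgroupP.
pose NF g := exists u (i e d : bool),
  tau_subgroup u /\ g = u * t ^+ i * s0 ^+ e * s1 ^+ d.
have NF_t x : NF x -> NF (t * x).
  move=> [u [i [e [d [Fu ->]]]]].
  have tu := t_comm Fu; case: i.
    exists (u * tau), false, e, d; split; first exact: is_subgroupM.
    by rewrite !expgb mulg1 !mulgA tu tauE -[u * t * t]mulgA.
  by exists u, true, e, d; split=> //; rewrite !expgb mulg1 !mulgA tu.
have NF_1 x : NF x -> NF (s1 * x).
  move=> [u [i [e [d [Fu ->]]]]].
  have s1t : s1 * t = t^-1 * s1 by rewrite -s1J -[RHS]mulgA star_gen_sq mulg1.
  have s1e : s1 * s0 ^+ e = s0 ^+ e * s1 by apply/commuteX/commute_sym/s0_comm.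
  have s1d : s1 * s1 ^+ d = s1 ^+ (~~ d).
    by case: d; rewrite !expgb ?star_gen_sq ?mulg1.
  (* The correction comes from t^-1 = tau^-1 * t. *)
  pose w := if i then tau^-1 else 1 : W.
  have s1i : s1 * t ^+ i = w * t ^+ i * s1.
    rewrite /w; case: (i); rewrite !expgb ?mulg1 ?mul1g // s1t.
    by rewrite tauE invgM mulgVK.
  exists (u^-1 * w), i, e, (~~ d); split.
    apply: is_subgroupM => //; first exact: is_subgroupV.
    by rewrite /w; case: (i) => //; [exact: is_subgroupV | exact: is_subgroup1].
  rewrite -s1d !mulgA s1_inv // -(mulgA _ s1 (t ^+ i)) s1i !mulgA.
  by rewrite -(mulgA _ s1 (s0 ^+ e)) s1e !mulgA.
have NF_0 x : NF x -> NF (s0 * x).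
  move=> [u [i [e [d [Fu ->]]]]].
  have s0e : s0 * s0 ^+ e = s0 ^+ (~~ e).
    by case: e; rewrite !expgb ?star_gen_sq ?mulg1.
  exists u, i, (~~ e), d; split=> //.
  rewrite -s0e !mulgA s0_comm_tau // -(mulgA _ s0 (t ^+ i)).
  by have -> : s0 * t ^+ i = t ^+ i * s0 by [apply: commuteX]; rewrite !mulgA.
elim/star_ind: g => [|i x].
  exists 1, false, false, false; split; first exact: is_subgroup1.
  by rewrite !mulg1.
case: (unliftP ord0 i) => [j ->|->]; last exact: NF_0.
case: (unliftP ord0 j) => [j' ->|->] NFx; last exact: NF_1.
have -> : star_gen m (lift ord0 (lift ord0 j')) = s1 * t.
  rewrite tE mulgA star_gen_sq mul1g; congr star_gen; apply/val_inj => /=.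
  by rewrite (ord1 j').
by rewrite -mulgA; apply/NF_1/NF_t.
Qed.

Lemma tau_finite_index : finite_index tau_subgroup.
Proof.
have /choice[k kP] g : exists k : bool * bool * bool, exists u, tau_subgroup u /\
    g = u * (t ^+ k.1.1 * s0 ^+ k.1.2 * s1 ^+ k.2).
  by have [u [i [e [d [Fu ->]]]]] := tau_normal_form g; exists (i, e, d), u; rewrite !mulgA.
exists (bool * bool * bool)%type, k => x y kxy.
have [[u [Fu ->]] [w [Fw ->]]] := (kP x, kP y).
by rewrite kxy invgM mulgA mulgK; apply: (proj2 tau_subgroupP).
Qed.

(** Write g = v * s_0^e * s_1^d with [v] a power of [t]. The central factor squares to 1; moreover
    v^2 lies in <tau>, and v * s_1 is an involution since s_1 inverts [v]. *)
Lemma tau_subgroup_sq g : tau_subgroup (g * g).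
Proof.
have [u [i [e [d [Fu ->]]]]] := tau_normal_form g.
have s1V : s1^-1 = s1 by exact: star_genV.
pose v := u * t ^+ i.
have vv : tau_subgroup (v * v).
  rewrite -expg2 expgMn; last exact/commuteX/commute_sym/t_comm.
  apply: (is_subgroupM tau_subgroupP).
    by rewrite expg2; apply: (is_subgroupM tau_subgroupP).
  rewrite -expgnA mulnC expgnA expg2 -tauE.
  by case: (i); [exact: tau_in | exact: is_subgroup1 tau_subgroupP].
have s1v : s1 * v = v^-1 * s1.
  rewrite /v mulgA s1_inv // -mulgA; apply: (mulgI u); rewrite mulVKg.
  rewrite invgM !mulgA; have uti : commute u (t ^- i).
    exact/commuteV/commuteX/commute_sym/t_comm.
  rewrite uti mulgK; case: (i); rewrite !expgb ?invg1 ?mul1g ?mulg1 //.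
  by apply: (mulIg s1^-1); rewrite mulgK s1V s1J.
have s0v : commute (s0 ^+ e) v.
  apply: commuteM; apply/commute_sym/commuteX/commute_sym.
    exact: s0_comm_tau.
  exact: commuteX.
have s01 : commute (s0 ^+ e) (s1 ^+ d) by apply: commuteX2; exact: s0_comm.
have -> : v * s0 ^+ e * s1 ^+ d = v * s1 ^+ d * s0 ^+ e by rewrite -mulgA s01 mulgA.
have cg : commute (v * s1 ^+ d) (s0 ^+ e) by apply/commute_sym/commuteM.
have ce : s0 ^+ e ^+ 2 = 1.
  by case: (e); rewrite !expgb ?expg1n // expg2 star_gen_sq.
rewrite -expg2 expgMn // ce mulg1 expg2.
case: (d); rewrite !expgb ?mulg1 //.
rewrite -(mulgA v s1) (mulgA s1 v) s1v -(mulgA v^-1) star_gen_sq mulg1 mulgV.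
exact: is_subgroup1 tau_subgroupP.
Qed.

Lemma tau_inj a b : tau ^+ a = tau ^+ b -> a = b.
Proof.
wlog ab : a b / a <= b => [wl|tab].
  by case: (leqP a b) => [|/ltnW] ab; [apply: wl | move/esym/wl => -> //].
have : tau ^+ (b - a) = 1 by rewrite expgnFr // tab mulgV.
by move/dihedral_tau_order/eqP; rewrite subn_eq0 => ba; apply/anti_leq; rewrite ab.
Qed.

Lemma tau_subgroupE u : tau_subgroup u -> exists k, u = tau ^+ k \/ u = tau ^- k.
Proof.
move=> [a [b ->]]; case: (leqP a b) => [|/ltnW] ab.
  by exists (b - a); right; rewrite expgnFr // invgM invgK.
by exists (a - b); left; rewrite expgnFr.
Qed.

(** [tau] is a square, so [phi] and its inverse send it to powers of [tau], whose exponents multiply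
    to 1. *)
Lemma dihedral_morph_tau (phi : W -> W) :
  {morph phi : x y / x * y} -> bijective phi -> phi tau = tau \/ phi tau = tau^-1.
Proof.
move=> phiM [psi phiK psiK].
have psiM : {morph psi : x y / x * y}.
  by move=> x y; apply: (can_inj phiK); rewrite phiM !psiK.
have sqE (f : W -> W) : {morph f : x y / x * y} -> tau_subgroup (f tau).
  by move=> fM; rewrite tauE fM; apply: tau_subgroup_sq.
have phiX k x : phi (x ^+ k) = phi x ^+ k.
  by elim: k => [|k IH]; rewrite ?(morph_one phiM) // !expgS phiM IH.
have [k kE] := tau_subgroupE (sqE _ phiM).
have [l lE] := tau_subgroupE (sqE _ psiM).
have : tau = phi tau ^+ l \/ tau = phi tau ^- l.
  by case: lE => lE; [left|right]; rewrite -phiX -?(morph_inv phiM) -lE psiK.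
have E1 : tau = tau ^+ (k * l) -> k = 1%N.
  by rewrite -[X in X = _]expg1 => /tau_inj/esym/eqP; rewrite muln_eq1 => /andP[/eqP].
have E2 : tau <> tau ^- (k * l).
  move=> E; have := dihedral_tau_order (k := (k * l).+1); rewrite expgS {1}E mulVg.
  by move=> /(_ erefl).
case: kE => -> []; rewrite ?expVgn ?invgK -expgnA => E.
- by left; rewrite (E1 E).
- by case: (E2 E).
- by case: (E2 E).
- by right; rewrite (E1 E).
Qed.

Lemma dihedral_R_infinity : R_infinity W.
Proof.
move=> phi phi_bij; have phiM := @gmulfM _ _ phi.
move=> /(finite_twisted_reps phiM tau_finite_index)[s sP].
(* Twisting by <tau> fixes every tau^k * c, where c = 1 if [phi] fixes [tau] and c = s_1 if it
   inverts [tau]. *)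
have [c cP] : exists c, forall u k, tau_subgroup u ->
    u * (tau ^+ k * c) * (phi u)^-1 = tau ^+ k * c.
  have phiX k x : phi (x ^+ k) = phi x ^+ k.
    by elim: k => [|k IH]; rewrite ?(morph_one phiM) // !expgS phiM IH.
  have tauX k : tau_subgroup (tau ^+ k) by exists k, 0; rewrite expg0 invg1 mulg1.
  have [ptau|ptau] := dihedral_morph_tau phiM phi_bij; [exists 1|exists s1] => u k Fu.
    have -> : phi u = u.
      by case: Fu => a [b ->]; rewrite phiM (morph_inv phiM) !phiX ptau.
    by rewrite mulg1 (tau_subgroup_comm Fu (tauX k)) mulgK.
  have -> : phi u = u^-1.
    case: Fu => a [b ->]; rewrite phiM (morph_inv phiM) !phiX ptau !expVgn.
    by rewrite invgM !invgK commX.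
  rewrite invgK mulgA (tau_subgroup_comm Fu (tauX k)) -!mulgA s1_inv //.
  by rewrite mulVKg.
pose rep k := s2val (cid2 (sP (tau ^+ k * c))).
have [k [l [kl same]]] : exists k l, k < l /\ rep k = rep l.
  apply: contrapT => none.
  suff : size (map rep (iota 0 (size s).+1)) <= size s by rewrite size_map size_iota ltnn.
  apply: uniq_leq_size; last first.
    by move=> _ /mapP[k _ ->]; exact: (s2valP (cid2 (sP (tau ^+ k * c)))).
  rewrite map_inj_in_uniq ?iota_uniq // => k l _ _ kl.
  by case: (ltngtP k l) => // lt; case: none; [exists k, l | exists l, k].
have [h Fh kE] := s2valP' (cid2 (sP (tau ^+ k * c))).
have [h' Fh' lE] := s2valP' (cid2 (sP (tau ^+ l * c))).
rewrite -/(rep k) in kE; rewrite -/(rep l) -same in lE.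
(* A shared representative makes tau^l * c a twist of tau^k * c by this element, hence equal to
   it. *)
have Fu : tau_subgroup (h' * h^-1) by apply: (proj2 tau_subgroupP).
have : tau ^+ l * c = tau ^+ k * c.
  by rewrite -(cP _ k Fu) kE lE phiM (morph_inv phiM) invgM invgK !mulgA !mulgVK.
by move/mulIg/tau_inj => lk; rewrite lk ltnn in kl.
Qed.
End Dihedral.

(** * Choice of the translations, and conclusion *)

HB.instance Definition _ (U V : finZmodType) := Finite.on (U * V)%type.

Lemma pair_mulrn (U V : nmodType) (x : U) (y : V) k :
  ((x, y) *+ k = (x *+ k, y *+ k))%R.
Proof. by elim: k => [|k IH]; rewrite ?GRing.mulr0n // !GRing.mulrS IH. Qed.

(** Two directions suffice: as m j2 > 2, the multiples 1 and 2 of v j2 are distinct and nonzero. The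
    other rotations act trivially. *)
Lemma star_R_infinity_large (n : nat) (m : 'I_n -> nat) (j1 j2 : 'I_n) :
  j2 != j1 -> 1 < m j1 -> 2 < m j2 -> R_infinity (star_coxeter m).
Proof.
move=> j21 m1 m2; pose V : finZmodType := ('Z_(m j1) * 'Z_(m j2))%type.
pose v j : V := (if j == j1 then (1, 0) else if j == j2 then (0, 1) else (0, 0))%R.
have v1 : v j1 = (1, 0)%R by rewrite /v eqxx.
have v2 : v j2 = (0, 1)%R by rewrite /v (negPf j21) eqxx.
have y2 : (v j2 *+ 1 = (0, 1))%R by [].
have y3 : (v j2 *+ 2 = (0, 1 + 1))%R by rewrite v2 pair_mulrn GRing.mul0rn.
have w2 : (v j1 + (0, 1) = (1, 1))%R.
  by rewrite v1; congr (_, _); rewrite ?GRing.addr0 ?GRing.add0r.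
have w3 : (v j1 + (0, 1 + 1) = (1, 1 + 1))%R.
  by rewrite v1; congr (_, _); rewrite ?GRing.addr0 ?GRing.add0r.
have n10 : (1 == 0 :> 'Z_(m j1))%R = false by exact: GRing.oner_eq0.
have n20 : (1 + 1 == 0 :> 'Z_(m j2))%R = false.
  apply/eqP => /(congr1 (@nat_of_ord _)).
  by rewrite -[(1 + 1)%R]/(2%:R)%R val_Zp_nat ?(ltnW m2) // modn_small.
have notin4 (y : 'Z_(m j2)) : y != 0%R ->
    ((1%R, y) : V) \notin [:: 0; (1, 0); (0, 1); (0, 1 + 1)]%R.
  by move=> /negPf y0; rewrite !inE !xpair_eqE n10 y0 !andbF.
apply: (star_R_infinity_voltage (v := v) (j1 := j1) (j2 := j2) (j3 := j2) (r2 := 1%N) (r3 := 2)) => //.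
- move=> j; rewrite /v; case: eqP => [->|_].
    by rewrite pair_mulrn pchar_Zp // GRing.mul0rn.
  by case: eqP => [->|_]; rewrite pair_mulrn ?GRing.mul0rn ?pchar_Zp // ltnW.
- by rewrite y2 y3 w2 v1; apply: notin4; rewrite GRing.oner_eq0.
- by rewrite y2 y3 w3 v1; apply: notin4; rewrite n20.
rewrite y2 y3 xpair_eqE eqxx /=; apply/eqP.
by rewrite -[X in X = _]GRing.addr0 => /GRing.addrI/eqP; rewrite eq_sym GRing.oner_eq0.
Qed.

(** With all orders 2 a direction has a single nonzero multiple, so a third independent direction
    supplies the second parallelogram. *)
Lemma star_R_infinity_right_angled (n : nat) (m : 'I_n -> nat) (j1 j2 j3 : 'I_n) :
  j2 != j1 -> j3 != j1 -> j2 != j3 -> (forall j, m j = 2) -> R_infinity (star_coxeter m).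
Proof.
move=> j21 j31 j23 m2; pose V : finZmodType := ('Z_2 * ('Z_2 * 'Z_2))%type.
pose v j : V := (if j == j1 then (1, 0) else if j == j2 then (0, (1, 0)) else
  if j == j3 then (0, (0, 1)) else 0)%R.
have v1 : v j1 = (1, 0)%R by rewrite /v eqxx.
have v2 : v j2 = (0, (1, 0))%R by rewrite /v (negPf j21) eqxx.
have v3 : v j3 = (0, (0, 1))%R by rewrite /v (negPf j31) eq_sym (negPf j23) eqxx.
apply: (star_R_infinity_voltage (v := v) (j1 := j1) (j2 := j2) (j3 := j3) (r2 := 1%N) (r3 := 1%N)) => //.
- by move=> j; rewrite m2; case: (v j) => [a [b c]]; rewrite !pair_mulrn;
    congr (_, (_, _)); rewrite -GRing.mulr_natr pchar_Zp // GRing.mulr0.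
- by rewrite v1 v2 v3.
- by rewrite v1 v2 v3.
by rewrite v2 v3.
Qed.

Local Close Scope group_scope.

Theorem theorem4p10 (n : nat) (m : 'I_n -> nat)
  (n_ge2 : 2 <= n)
  (m_ge2 : forall j : 'I_n, 2 <= m j)
  (m_even : exists j : 'I_n, ~~ odd (m j)) :
  R_infinity (star_coxeter m).
Proof.
have [[j2 m3]|no3] := pselect (exists j, 2 < m j).
  have [j1 j21] : exists j1, j2 != j1.
    have /card_gt1P[a [b [_ _ ab]]] : 1 < #|'I_n| by rewrite card_ord.
    by have [j2a|nj2a] := eqVneq j2 a; [exists b; rewrite j2a | exists a].
  exact: star_R_infinity_large j21 (m_ge2 j1) m3.
have m2 j : m j = 2.
  apply/eqP; rewrite eqn_leq m_ge2 leqNgt andbT.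
  by apply/negP => m3; apply: no3; exists j.
(* All m_j equal 2: n = 2 is the dihedral case, and n >= 3 provides three directions. *)
case: n => [|[|[|n]]] // in m n_ge2 m_ge2 m_even no3 m2 *.
  exact: dihedral_R_infinity.
exact: (star_R_infinity_right_angled (j1 := ord0) (j2 := Ordinal (isT : 1 < n.+3))
  (j3 := Ordinal (isT : 2 < n.+3))).
Qed.
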